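(* Let $\Gamma$ be a nonnegative oriented ribbon graph of a connected trivalent graph $G$ with trivial automorphism group. The vertex polynomial of $G$, evaluated at $n\in\mathbb{N}$, is $$V(G,n)=2\left(\sum_{\Gamma'\text{ even}}P_n(\Gamma')-\sum_{\Gamma'\text{ odd}}P_n(\Gamma')\right),$$ where the first (second) sum is over all distinct oriented ribbon graphs $\Gamma'$ of $G$ that are even (odd) with respect to $\Gamma$, and $P_n(\Gamma')$ is the number of partial $n$-face colorings of $\Gamma'$. Here a ribbon graph $\Gamma'$ is even or odd with respect to $\Gamma$ based upon the parity of the number of half-twists that need to be inserted into its bands to make it equivalent to $\Gamma$.
   Context: Graphs are finite multigraphs: loops and multiple edges are allowed, and so are ''vertex-less'' edges (circles, also regarded as loops). Trivalent means every vertex has degree 3 (a loop at a vertex counts twice). A ribbon graph $\Gamma$ of $G$ is a surface with boundary in which $G$ is embedded and which deformation retracts onto $G$; combinatorially it is given by a cyclic ordering of the half-edges at each vertex and a sign for each edge (a disc for each vertex, a band for each edge, a half-twist in the bands of negative edges; a vertex-less edge gives an annulus or Möbius band). Capping boundary circles by discs gives a closed surface $\overline\Gamma$; these discs are the faces of $\Gamma$. Two ribbon graphs $\Gamma_1,\Gamma_2$ are equivalent if there is a homeomorphism $\overline\Gamma_1\to\overline\Gamma_2$ inducing an isomorphism of the underlying graphs; ribbon graphs are distinct if they are not equivalent. An orientation of a ribbon graph, if one exists, is an orientation of the surface. For $\nu\in\{0,1\}^V$, $\Gamma_\nu$ is the ribbon graph obtained from $\Gamma$ by inserting, for each vertex $v$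 with $\nu_v=1$, a half-twist in each of the three half-bands at $v$ (two half-twists in one band cancel); $k_\nu$ is its number of boundary circles and $|\nu|=\sum_v\nu_v$. The vertex polynomial of a ribbon graph is $V(\Gamma,n)=\sum_{\nu\in\{0,1\}^V}(-1)^{|\nu|}n^{k_\nu}$. An oriented ribbon graph $\Gamma$ of $G$ is nonnegative if $V(\Gamma,n)\ge 0$ for large $n\in\mathbb{N}$. The vertex polynomial of the connected trivalent graph $G$ is $V(G,n):=V(\Gamma,n)$ for any nonnegative oriented ribbon graph $\Gamma$ of $G$ (it is independent of the choice). A partial $n$-face coloring of a ribbon graph is an assignment of one of $n$ fixed colors to each face such that at every vertex at least two different colors occur among the faces incident to that vertex (i.e. at its three corners). *)

(* Defs.v *)
From HB Require Import structures.
From mathcomp Require Import all_boot all_order all_fingroup all_algebra.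
From mathcomp Require Import boolp classical_sets.

Set Implicit Arguments.
Unset Strict Implicit.
Unset Printing Implicit Defensive.

Import Order.TTheory GRing.Theory Num.Theory.
Local Open Scope set_scope.
Local Open Scope ring_scope.

(* Finite multigraphs with all vertices of degree 3.  An edge is a pair
   {d, drev d} of darts (half-edges); [src d] is the vertex at which [d] is
   attached.  A vertex-less edge (a circle) is a pair of darts with source
   [None], the two darts being its two directions.  The two darts of a loop
   have the same source, so that a loop counts twice in the degree. *)
Record trivalent_graph := TrivalentGraph {
  vert : finType;
  dart : finType;
  drev : dart -> dart;
  src : dart -> option vert;
  drevK : involutive drev;
  drev_neq : forall d, drev d != d;
  src_drev : forall d, (src (drev d) == None) = (src d == None);
  deg3 : forall v, #|[set d | src d == Some v]| = 3%N
}.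

Section Graph.
Variable G : trivalent_graph.
Implicit Types (d : dart G) (v : vert G).

Definition dart_adj : rel (dart G) :=
  fun d d' => (d' == drev d) || ((src d != None) && (src d == src d')).

(* There is no isolated vertex, so connectedness can be read on darts; the
   existence of [d] excludes the empty graph. *)
Definition connected_graph : Prop :=
  exists d, forall d', connect dart_adj d d'.

(* Automorphisms act on vertices and on half-edges: reversing a loop or a
   circle, or exchanging two parallel edges, is a nontrivial automorphism. *)
Definition is_aut (f : {perm vert G}) (g : {perm dart G}) : bool :=
  [forall d, (g (drev d) == drev (g d)) && (src (g d) == omap f (src d))].

Definition trivial_aut : Prop :=
  forall f g, is_aut f g -> f = 1%g /\ g = 1%g.

(* The darts issuing from the disc that contains the origin of [d].  A circle
   is cut at a phantom point of degree 2, whose disc meets both its darts. *)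
Definition star d : {set dart G} :=
  if src d is Some v then [set d' | src d' == Some v] else [set d; drev d].

(* A rotation system [r] (counterclockwise order of the half-edges around each
   disc) with signs [s]; [s d = true] means that the band of [d] is negative. *)
Definition is_ribbon (x : {perm dart G} * {ffun dart G -> bool}) : bool :=
  [forall d, (porbit x.1 d == star d) && (x.2 (drev d) == x.2 d)].

Record ribbon := Ribbon { ribbon_val : _; _ : is_ribbon ribbon_val }.

HB.instance Definition _ := [isSub for ribbon_val].
HB.instance Definition _ := [Finite of ribbon by <:].

Definition rot (Gam : ribbon) : {perm dart G} := (val Gam).1.
Definition sgn (Gam : ribbon) : {ffun dart G -> bool} := (val Gam).2.

(* Insertion of one half-twist in each half-band belonging to [T]. *)
Definition twist_data (Gam : ribbon) (T : {set dart G}) :=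
  (rot Gam, [ffun d => sgn Gam d (+) (d \in T) (+) (drev d \in T)]).

Lemma twist_subproof Gam T : is_ribbon (twist_data Gam T).
Proof.
apply/forallP => d; rewrite /= !ffunE drevK.
have /forallP/(_ d)/andP[-> /eqP] := valP Gam.
by rewrite /sgn => -> /=; rewrite addbAC.
Qed.

Definition half_twist Gam T : ribbon := Ribbon (twist_subproof Gam T).

Definition vertex_twist (Gam : ribbon) (nu : {ffun vert G -> bool}) : ribbon :=
  half_twist Gam [set d | oapp nu false (src d)].

(* [phi] records the discs on which the homeomorphism reverses the local
   orientation; [g] is the induced automorphism of the graph. *)
Definition ribbon_equiv : rel ribbon := fun Gam1 Gam2 =>
  [exists f : {perm vert G}, exists g : {perm dart G},
   exists phi : {ffun dart G -> bool},
   is_aut f g &&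
   [forall d,
    [&& phi (rot Gam1 d) == phi d,
        g (rot Gam1 d) ==
          (if phi d then (rot Gam2)^-1%g (g d) else rot Gam2 (g d))
      & sgn Gam2 (g d) == sgn Gam1 d (+) phi d (+) phi (drev d)]]].

(* [o] tells for each disc whether its orientation as a disc of [Gam] has to be
   reversed to get the orientation of the surface. *)
Definition is_orientation (Gam : ribbon) (o : {ffun dart G -> bool}) : bool :=
  [forall d, (o (rot Gam d) == o d) && (sgn Gam d == o d (+) o (drev d))].

Definition orientable (Gam : ribbon) : bool :=
  [exists o, is_orientation Gam o].

(* The boundary of the surface is cut into the sides (d, b) of the half-bands,
   b = false being the left side seen from the disc.  At its disc the left side
   of d meets the right side of the next half-band; a positive band joins left
   sides to right sides. *)
Definition side : finType := (dart G * bool)%type.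

Definition corner_mate (Gam : ribbon) (x : side) : side :=
  if x.2 then ((rot Gam)^-1%g x.1, false) else (rot Gam x.1, true).

Definition band_mate (Gam : ribbon) (x : side) : side :=
  (drev x.1, x.2 (+) ~~ sgn Gam x.1).

Definition side_adj (Gam : ribbon) : rel side :=
  fun x y => (y == corner_mate Gam x) || (y == band_mate Gam x).

(* The boundary circles, or equivalently the faces capping them. *)
Definition faces (Gam : ribbon) : {set {set side}} :=
  equivalence_partition (connect (side_adj Gam)) [set: side].

Definition incident v (F : {set side}) : bool :=
  [exists x in F, src x.1 == Some v].

Definition face (Gam : ribbon) : finType := {F : {set side} | F \in faces Gam}.

Definition partial_coloring (Gam : ribbon) (n : nat)
    (c : {ffun face Gam -> 'I_n}) : bool :=
  [forall v, exists F1, exists F2,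
    [&& incident v (val F1), incident v (val F2) & c F1 != c F2]].

Definition num_partial_colorings (n : nat) (Gam : ribbon) : nat :=
  #|[set c : {ffun face Gam -> 'I_n} | partial_coloring c]|.

Definition ribbon_vertex_poly (Gam : ribbon) : {poly int} :=
  \sum_(nu : {ffun vert G -> bool})
    (-1) ^+ #|[set v | nu v]| *: 'X^#|faces (vertex_twist Gam nu)|.

Definition nonnegative (Gam : ribbon) : Prop :=
  exists N : nat, forall n : nat, (N <= n)%N ->
    0 <= (ribbon_vertex_poly Gam).[n%:R].

Definition vertex_poly : {poly int} :=
  xget 0 (fun p => exists Gam : ribbon,
    [/\ orientable Gam, nonnegative Gam & p = ribbon_vertex_poly Gam]).

(* One representative of each class of orientable ribbon graphs.  Equivalences
   may reverse the orientation, so the two orientations of a ribbon graph are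
   not counted separately. *)
Definition distinct_oriented : {set ribbon} :=
  let D := [set Gam | orientable Gam] in
  transversal (equivalence_partition ribbon_equiv D) D.

Definition twist_parity (b : bool) (Gam Gam' : ribbon) : bool :=
  [exists T : {set dart G},
    (odd #|T| == b) && ribbon_equiv (half_twist Gam' T) Gam].

Definition even_wrt := twist_parity false.
Definition odd_wrt := twist_parity true.

End Graph.

(* Main.v *)
(** Triviality of the automorphism group forces every dart to have a source,
    so a ribbon graph is a choice of rotations and signs over vertices of degree
    3, and the equivalences are exactly the reversals of sets of discs.  The
    ribbon graphs [Gam_nu], for [nu] in {0,1}^V, are orientable and meet each
    equivalence class of orientable ribbon graphs exactly twice, at [nu] and its
    complement; the parity of the class is the parity of [|nu|].  Hence the
    right-hand side is the sum over [nu] of (-1)^|nu| P_n(Gam_nu), whereas the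
    left-hand side counts in the same way all the face colorings of [Gam_nu],
    which are colorings of the sides of the half-bands compatible with the
    gluings.  A coloring that is monochromatic at a vertex [v] is compatible
    with the gluings of [Gam_nu] if and only if it is so after toggling [nu] at
    [v], so that all these colorings cancel and only the partial colorings
    remain. *)
Require Import Defs.
From mathcomp Require Import all_boot all_order all_fingroup all_algebra.
From mathcomp Require Import zify.
From mathcomp Require classical_sets.
(* [rot] must denote the rotation of a ribbon graph, not [seq.rot]. *)
Import Defs.
Import Order.TTheory GRing.Theory Num.Theory.
Local Open Scope ring_scope.

Set Implicit Arguments.
Unset Strict Implicit.
Unset Printing Implicit Defensive.

(** * Vertex twists and reversals of discs *)

Definition at_dart (G : trivalent_graph) (nu : {ffun vert G -> bool}) (d : dart G) :=
  oapp nu false (src d).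

Ltac at_dart_cases :=
  repeat match goal with |- context [at_dart ?nu ?d] => case: (at_dart nu d) end.

Section Ribbons.
Variable G : trivalent_graph.
Implicit Types (d e : dart G) (v : vert G) (A B C : ribbon G).
Implicit Types (nu mu psi : {ffun vert G -> bool}).

Definition addf nu mu : {ffun vert G -> bool} := [ffun v => nu v (+) mu v].

Lemma at_dartD nu mu d : at_dart (addf nu mu) d = at_dart nu d (+) at_dart mu d.
Proof. by rewrite /at_dart; case: (src d) => //= v; rewrite ffunE. Qed.

Lemma addfK nu : involutive (addf nu).
Proof. by move=> mu; apply/ffunP=> v; rewrite !ffunE addKb. Qed.

Lemma porbit_rot A d : porbit (rot A) d = star d.
Proof. by have /forallP/(_ d)/andP[/eqP] := valP A. Qed.

Lemma sgn_drev A d : sgn A (drev d) = sgn A d.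
Proof. by have /forallP/(_ d)/andP[_ /eqP] := valP A. Qed.

Lemma src_rot A d : src (rot A d) = src d.
Proof.
have : rot A d \in star d by rewrite -(porbit_rot A) (mem_porbit _ 1).
rewrite /star; case E : (src d) => [v|]; rewrite !inE; first by move/eqP.
case/orP=> /eqP ->; first by rewrite E.
by apply/eqP; rewrite src_drev E.
Qed.

Lemma src_rotV A d : src ((rot A)^-1%g d) = src d.
Proof. by rewrite -(src_rot A) permKV. Qed.

Lemma at_dart_rot nu A d : at_dart nu (rot A d) = at_dart nu d.
Proof. by rewrite /at_dart src_rot. Qed.

Lemma at_dart_rotV nu A d : at_dart nu ((rot A)^-1%g d) = at_dart nu d.
Proof. by rewrite /at_dart src_rotV. Qed.

Lemma sgn_half_twist A T d :
  sgn (half_twist A T) d = sgn A d (+) (d \in T) (+) (drev d \in T).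
Proof. by rewrite /sgn /= ffunE. Qed.

Lemma sgn_vertex_twist A nu d :
  sgn (vertex_twist A nu) d = sgn A d (+) at_dart nu d (+) at_dart nu (drev d).
Proof. by rewrite sgn_half_twist !inE. Qed.

Lemma ribbon_inj A B : rot A = rot B -> sgn A =1 sgn B -> A = B.
Proof.
move=> rE /ffunP sE; apply: val_inj; move: rE sE; rewrite /rot /sgn.
by case: (val A) (val B) => [r s] [r' s'] /= -> ->.
Qed.

Lemma vertex_twistD A mu nu :
  vertex_twist (vertex_twist A mu) nu = vertex_twist A (addf mu nu).
Proof.
apply: ribbon_inj => // d; rewrite !sgn_vertex_twist !at_dartD.
by case: (sgn _ _); at_dart_cases.
Qed.

Lemma orientable_vertex_twist A nu : orientable A -> orientable (vertex_twist A nu).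
Proof.
case/existsP=> o /forallP oP; apply/existsP; exists [ffun d => o d (+) at_dart nu d].
apply/forallP=> d; have /andP[/eqP o1 /eqP o2] := oP d.
rewrite sgn_vertex_twist o2 !ffunE at_dart_rot o1 eqxx /=.
by apply/eqP; case: (o d); case: (o (drev d)); at_dart_cases.
Qed.

(** The product form of $(-1)^{|\nu|}$ makes it multiplicative under [addf]. *)
Definition sgnf nu : int := \prod_v (-1) ^+ nu v.

Lemma sgnf_card nu : (-1) ^+ #|[set v | nu v]| = sgnf nu.
Proof.
rewrite /sgnf -sum1_card big_mkcond /= -prodrXr; apply: eq_bigr => v _.
by rewrite inE; case: (nu v).
Qed.

Lemma sgnfD nu mu : sgnf (addf nu mu) = sgnf nu * sgnf mu.
Proof. by rewrite /sgnf -big_split; apply: eq_bigr => v _; rewrite ffunE signr_addb. Qed.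

(* The homeomorphism reversing exactly the discs of [psi] and inducing the
   identity of the graph. *)
Definition flips psi A B : Prop := forall d,
  rot A d = (if at_dart psi d then (rot B)^-1%g d else rot B d)
  /\ sgn B d = sgn A d (+) at_dart psi d (+) at_dart psi (drev d).

(** Rotations stay within a disc, where [psi] is constant, so the rule for [rot A] can be inverted
    disc by disc. *)
Lemma flipsV psi A B d : flips psi A B ->
  (rot A)^-1%g d = if at_dart psi d then rot B d else (rot B)^-1%g d.
Proof.
move=> fl; apply: (canLR (permK _)); case: ifP => E;
  case: (fl (if at_dart psi d then rot B d else (rot B)^-1%g d)) => + _;
by rewrite E ?at_dart_rot ?at_dart_rotV E ?permK ?permKV.
Qed.

Lemma flips_sym psi A B : flips psi A B -> flips psi B A.
Proof.
move=> fl d; have [r s] := fl d; rewrite s (flipsV _ fl) r.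
by split; [case: (at_dart _ _) | case: (sgn _ _); at_dart_cases].
Qed.

Lemma flips_trans psi phi A B C :
  flips psi A B -> flips phi B C -> flips (addf psi phi) A C.
Proof.
move=> flAB flBC d; have [r s] := flAB d; have [r' s'] := flBC d.
rewrite r r' (flipsV _ flBC) s' s !at_dartD; split.
  by at_dart_cases.
by case: (sgn _ _); at_dart_cases.
Qed.

Lemma flips_vertex_twist psi nu A B :
  flips psi A B -> flips psi (vertex_twist A nu) (vertex_twist B nu).
Proof.
move=> fl d; have [r s] := fl d; split; first exact: r.
by rewrite !sgn_vertex_twist s; case: (sgn _ _); at_dart_cases.
Qed.

(** * Face colorings as colorings of the sides of half-bands *)

Section Colorings.
Variable n : nat.
Implicit Type c : {ffun side G -> 'I_n}.

(** Compatibility with the gluings amounts to constancy on boundary circles. Unlike face colorings,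
    these live in a type independent of the ribbon graph, so one [c] can be tested against all the
    twists of [A]. *)
Definition side_coloring A c : bool :=
  [forall x, (c (corner_mate A x) == c x) && (c (band_mate A x) == c x)].

Definition monochromatic c v : bool :=
  [forall x : side G, forall y : side G,
     (src x.1 == Some v) ==> (src y.1 == Some v) ==> (c x == c y)].

Definition proper c : bool := [forall v, ~~ monochromatic c v].

Lemma corner_mateK A : involutive (corner_mate A).
Proof. by move=> [d []]; rewrite /corner_mate /= ?permK ?permKV. Qed.

Lemma band_mateK A : involutive (band_mate A).
Proof. by move=> [d b]; rewrite /band_mate /= drevK sgn_drev addbK. Qed.

Lemma side_adj_sym A : symmetric (side_adj A).
Proof.
move=> x y; rewrite /side_adj; congr (_ || _); rewrite eq_sym inv_eq //.
  exact: corner_mateK.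
exact: band_mateK.
Qed.

Lemma side_connect_equiv A : {in setT & &, equivalence_rel (connect (side_adj A))}.
Proof.
have sym := sym_connect_sym (@side_adj_sym A).
move=> x y z _ _ _; split=> // xy; exact: same_connect.
Qed.

Lemma faces_partition A : partition (faces A) [set: side G].
Proof. exact: equivalence_partitionP (@side_connect_equiv A). Qed.

Lemma face_of_subproof A (x : side G) : pblock (faces A) x \in faces A.
Proof. by rewrite pblock_mem // (cover_partition (faces_partition A)) inE. Qed.

Definition face_of A (x : side G) : face A :=
  exist (fun F => F \in faces A) _ (face_of_subproof A x).


Lemma mem_faceP A (F : face A) (x : side G) : (x \in val F) = (F == face_of A x).
Proof.
have tr := partition_trivIset (faces_partition A).
have cov : x \in cover (faces A) by rewrite (cover_partition (faces_partition A)) inE.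
rewrite -val_eqE /=; apply/idP/eqP=> [xF | ->]; last by rewrite mem_pblock.
by rewrite (def_pblock tr (valP F) xF).
Qed.

Lemma face_of_eq A x y : (face_of A x == face_of A y) = connect (side_adj A) x y.
Proof.
rewrite -mem_faceP /=.
by rewrite (pblock_equivalence_partition (@side_connect_equiv A)) ?inE.
Qed.

Lemma face_inh A (F : face A) : exists x, x \in val F.
Proof.
apply/set0Pn; apply: contraTneq (valP F) => ->.
by have /and3P[_ _] := faces_partition A.
Qed.

Definition sides_of_faces A (c : {ffun face A -> 'I_n}) : {ffun side G -> 'I_n} :=
  [ffun x => c (face_of A x)].

Lemma sides_of_faces_inj A : injective (@sides_of_faces A).
Proof.
move=> c1 c2 /ffunP E; apply/ffunP=> F; have [x] := face_inh F.
by rewrite mem_faceP => /eqP ->; have := E x; rewrite !ffunE.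
Qed.

Lemma side_coloring_connect A c x y :
  side_coloring A c -> connect (side_adj A) x y -> c x = c y.
Proof.
move=> /forallP cP; case/connectP=> p; elim: p x => [|z p IH] x /=; first by move=> _ ->.
case/andP=> + pz yE; rewrite -(IH z pz yE); have /andP[/eqP E1 /eqP E2] := cP x.
by case/orP=> /eqP ->.
Qed.

Lemma side_coloringP A c :
  side_coloring A c <-> exists c' : {ffun face A -> 'I_n}, c = sides_of_faces c'.
Proof.
split=> [cP|[c' ->]].
  exists [ffun F => c (xchoose (face_inh F))].
  apply/ffunP=> x; rewrite !ffunE; apply: (side_coloring_connect cP).
  by rewrite -face_of_eq -mem_faceP; exact: (xchooseP (face_inh _)).
apply/forallP=> x; rewrite !ffunE.
have E y : side_adj A x y -> c' (face_of A y) = c' (face_of A x).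
  by move=> xy; congr (c' _); apply/eqP; rewrite eq_sym face_of_eq connect1.
by rewrite !E ?eqxx // /side_adj eqxx ?orbT.
Qed.

Lemma partial_coloringE A (c : {ffun face A -> 'I_n}) :
  partial_coloring c = proper (sides_of_faces c).
Proof.
apply: eq_forallb => v; apply/existsP/idP.
  case=> F1 /existsP[F2 /and3P[/existsP[x /andP[xF xv]] /existsP[y /andP[yF yv]]]].
  apply: contra => /forallP/(_ x)/forallP/(_ y); rewrite xv yv !ffunE.
  by move: xF yF; rewrite !mem_faceP => /eqP -> /eqP ->.
rewrite negb_forall => /existsP[x]; rewrite negb_forall => /existsP[y].
rewrite !negb_imply !ffunE => /and3P[xv yv ne].
exists (face_of A x); apply/existsP; exists (face_of A y); rewrite ne andbT.
by apply/andP; split; apply/existsP; [exists x|exists y]; rewrite mem_faceP eqxx.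
Qed.

Lemma card_partial_colorings A :
  num_partial_colorings n A = #|[set c | side_coloring A c && proper c]|.
Proof.
rewrite /num_partial_colorings -(card_imset _ (@sides_of_faces_inj A)); congr #|pred_of_set _|.
apply/setP=> c; rewrite inE; apply/imsetP/andP.
  case=> c'; rewrite inE partial_coloringE => p ->; split=> //.
  by apply/side_coloringP; exists c'.
case=> /side_coloringP[c' ->] p; exists c' => //.
by rewrite inE partial_coloringE.
Qed.

Lemma card_side_colorings A :
  (n ^ #|faces A|)%N = #|[set c | side_coloring A c]|.
Proof.
have -> : [set c | side_coloring A c] = [set sides_of_faces c | c : {ffun face A -> 'I_n}].
  apply/setP=> c; rewrite inE; apply/idP/imsetP.
    by case/side_coloringP=> c' ->; exists c'; rewrite ?inE.
  by case=> c' _ ->; apply/side_coloringP; exists c'.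
by rewrite (card_imset _ (@sides_of_faces_inj A)) card_ffun card_ord card_sig.
Qed.

(** Reversing a disc exchanges the left and right sides of its half-bands. *)
Definition flip_side psi (x : side G) : side G := (x.1, x.2 (+) at_dart psi x.1).

Lemma flip_sideK psi : involutive (flip_side psi).
Proof. by move=> [d b]; rewrite /flip_side /= addbK. Qed.

Definition flip_coloring psi c : {ffun side G -> 'I_n} := [ffun x => c (flip_side psi x)].

Lemma flip_coloringK psi : involutive (flip_coloring psi).
Proof. by move=> c; apply/ffunP=> x; rewrite !ffunE flip_sideK. Qed.

Lemma side_coloring_flip psi A B c :
  flips psi A B -> side_coloring B c -> side_coloring A (flip_coloring psi c).
Proof.
move=> fl /forallP cP; apply/forallP=> -[d b]; rewrite !ffunE.
have /andP[/eqP E1 /eqP E2] := cP (flip_side psi (d, b)).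
have [r s] := fl d.
(* [flip_side psi] intertwines the gluings of [A] and [B], first at the corners, then along the
   bands. *)
have -> : flip_side psi (corner_mate A (d, b)) = corner_mate B (flip_side psi (d, b)).
  rewrite /flip_side /corner_mate /=.
  case: b {E1 E2} => /=; rewrite ?(flipsV _ fl) ?r;
    by case E: (at_dart psi d); rewrite /= ?at_dart_rot ?at_dart_rotV E.
have -> : flip_side psi (band_mate A (d, b)) = band_mate B (flip_side psi (d, b)).
  rewrite /flip_side /band_mate /= s; congr pair.
  by case: (sgn _ _); at_dart_cases; case: b {E1 E2}.
by rewrite E1 E2 eqxx.
Qed.

Lemma monochromatic_flip psi c v :
  monochromatic c v -> monochromatic (flip_coloring psi c) v.
Proof.
move=> /forallP m; apply/forallP=> x; apply/forallP=> y; rewrite !ffunE.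
by have /forallP/(_ (flip_side psi y)) := m (flip_side psi x).
Qed.

(** [flip_coloring psi] is an involution exchanging the two kinds of compatibility. The predicate
    [P] serves for proper colorings as well as for all colorings. *)
Lemma card_flips psi A B (P : pred {ffun side G -> 'I_n}) :
  flips psi A B -> (forall c, P (flip_coloring psi c) = P c) ->
  #|[set c | side_coloring A c && P c]| = #|[set c | side_coloring B c && P c]|.
Proof.
move=> fl PP; rewrite -(card_imset _ (inv_inj (flip_coloringK psi))).
congr #|pred_of_set _|; apply/setP=> c; rewrite (can_imset_pre _ (flip_coloringK psi)).
rewrite !inE PP; congr (_ && _); apply/idP/idP => [/(side_coloring_flip (flips_sym fl))|].
  by rewrite flip_coloringK.
exact: side_coloring_flip fl.
Qed.

Lemma num_partial_colorings_flips psi A B :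
  flips psi A B -> num_partial_colorings n A = num_partial_colorings n B.
Proof.
move=> fl; rewrite !card_partial_colorings; apply: (card_flips fl) => c.
apply: eq_forallb => v; congr negb; apply/idP/idP; last exact: monochromatic_flip.
by move/(monochromatic_flip psi); rewrite flip_coloringK.
Qed.

(* At a monochromatic vertex the sides may be reglued in any way. *)
Lemma side_coloring_toggle A nu c v : monochromatic c v ->
  side_coloring (vertex_twist A nu) c ->
  side_coloring (vertex_twist A (addf [ffun w => w == v] nu)) c.
Proof.
move=> /forallP m /forallP cP; rewrite -vertex_twistD.
have mono d b b' : at_dart [ffun w => w == v] d -> c (d, b) = c (d, b').
  rewrite /at_dart; case E: (src d) => [w|] //=; rewrite ffunE => /eqP wv.
  by have /forallP/(_ (d, b')) := m (d, b); rewrite /= E wv eqxx => /eqP.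
apply/forallP=> -[d b]; have /andP[-> _] := cP (d, b).
have E b1 : c (drev d, b1 (+) ~~ sgn (vertex_twist A nu) d) = c (d, b1).
  by have /andP[_ /eqP] := cP (d, b1).
rewrite vertex_twistD /band_mate /= sgn_vertex_twist !at_dartD.
move: E (mono d) (mono (drev d)); rewrite sgn_vertex_twist.
case: (at_dart [ffun w => w == v] d); case: (at_dart [ffun w => w == v] (drev d));
  rewrite /= => E m1 m2; apply/eqP.
(* The cases are: both ends of the band at [v], where the two half-twists cancel; only [d] at [v];
   only [drev d] at [v]; neither. In the middle cases the extra half-twist is absorbed by the single
   color at [v]. *)
- by rewrite -(E b); do !congr (c (_, _)); case: (sgn _ _); at_dart_cases.
- rewrite (m1 b (~~ b)) // -(E (~~ b)); congr (c (_, _)).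
  by case: b; case: (sgn _ _); at_dart_cases.
- by rewrite -(E b); exact: m2.
- by rewrite -(E b).
Qed.

Lemma sum_sgnf_mono A c v : monochromatic c v ->
  \sum_nu sgnf nu * (side_coloring (vertex_twist A nu) c)%:R = 0.
Proof.
move=> m; set S := \sum_nu _; set dl := [ffun w => w == v].
(* Toggling [nu] at [v] changes the sign of each term and nothing else. *)
suff : S = - S by lia.
rewrite {1}/S (reindex_inj (inv_inj (addfK dl))) /= -sumrN; apply: eq_bigr => nu _.
have -> : side_coloring (vertex_twist A (addf dl nu)) c = side_coloring (vertex_twist A nu) c.
  apply/idP/idP; last exact: side_coloring_toggle.
  by move/(side_coloring_toggle m); rewrite addfK.
have -> : sgnf (addf dl nu) = - sgnf nu; last by rewrite mulNr.
rewrite sgnfD -(sgnf_card dl) (_ : [set w | dl w] = [set v]) ?cards1 ?mulN1r //.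
by apply/setP=> w; rewrite !inE ffunE.
Qed.

Lemma horner_ribbon_vertex_poly A : (ribbon_vertex_poly A).[n%:R] =
  \sum_nu sgnf nu * (num_partial_colorings n (vertex_twist A nu))%:R.
Proof.
rewrite /ribbon_vertex_poly horner_sum.
(* The power $n^{k_\nu}$ counts all the colorings compatible with the gluings. *)
transitivity (\sum_nu \sum_c sgnf nu * (side_coloring (vertex_twist A nu) c)%:R).
  apply: eq_bigr => nu _; rewrite hornerZ hornerXn sgnf_card -natrX card_side_colorings.
  rewrite -mulr_sumr -sum1_card natr_sum big_mkcond; congr (_ * _).
  by apply: eq_bigr=> c _; rewrite inE; case: ifP.
(* With the sum over [nu] innermost, every coloring having a monochromatic vertex contributes 0. *)
transitivity (\sum_nu \sum_(c | proper c) sgnf nu * (side_coloring (vertex_twist A nu) c)%:R).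
  rewrite exchange_big [RHS]exchange_big [RHS]big_mkcond /=; apply: eq_bigr => c _.
  case: ifPn => //; rewrite negb_forall => /existsP[v]; rewrite negbK.
  exact: sum_sgnf_mono.
apply: eq_bigr => nu _; rewrite card_partial_colorings -mulr_sumr -sum1_card natr_sum.
congr (_ * _); rewrite big_mkcond [RHS]big_mkcond; apply: eq_bigr => c _.
by rewrite inE andbC; case: (proper c) => //=; case: ifP.
Qed.

End Colorings.

(** * Behavior of the vertex polynomial under reversals and twists *)

(** Counting colorings with two colors determines the number of faces, so no bijection between the
    faces has to be built. *)
Lemma card_faces_flips psi A B : flips psi A B -> #|faces A| = #|faces B|.
Proof.
move=> fl; apply: (@expnI 2) => //; rewrite !card_side_colorings.
have E C : #|[set c : {ffun side G -> 'I_2} | side_coloring C c]|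
    = #|[set c : {ffun side G -> 'I_2} | side_coloring C c && predT c]|.
  by apply: eq_card => c; rewrite !inE andbT.
by rewrite !E; apply: (card_flips fl).
Qed.

Lemma ribbon_vertex_poly_flips psi A B :
  flips psi A B -> ribbon_vertex_poly A = ribbon_vertex_poly B.
Proof.
move=> fl; apply: eq_bigr => nu _.
by rewrite (card_faces_flips (flips_vertex_twist nu fl)).
Qed.

Lemma ribbon_vertex_poly_twist A mu :
  ribbon_vertex_poly (vertex_twist A mu) = sgnf mu *: ribbon_vertex_poly A.
Proof.
rewrite /ribbon_vertex_poly (reindex_inj (inv_inj (addfK mu))) /= scaler_sumr.
apply: eq_bigr => nu _.
by rewrite vertex_twistD addfK scalerA !sgnf_card sgnfD.
Qed.

End Ribbons.

Lemma eventually_zero_poly (p : {poly int}) (N : nat) :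
  (forall n, (N <= n)%N -> p.[n%:R] = 0) -> p = 0.
Proof.
(* The [size p] consecutive integers from [N] on are roots, one more than the degree of a nonzero
   [p] allows. *)
move=> p0; apply: (@roots_geq_poly_eq0 _ p [seq (i%:R : int) | i <- iota N (size p)]).
- by apply/allP=> _ /mapP[i + ->]; rewrite mem_iota => /andP[Ni _]; apply/rootP/p0.
- by rewrite map_inj_uniq ?iota_uniq // => i j /eqP; rewrite eqr_nat => /eqP.
- by rewrite size_map size_iota.
Qed.

(** * Ribbon graphs over a graph with trivial automorphism group *)

Section TrivialAutomorphisms.
Variable G : trivalent_graph.
Hypothesis haut : trivial_aut G.
Implicit Types (d e : dart G) (v : vert G) (A B C : ribbon G).
Implicit Types (nu mu psi : {ffun vert G -> bool}).

(** This covers loops at a vertex as well as circles, whose two darts both have source [None]. *)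
Lemma is_aut_swap d : src (drev d) = src d -> is_aut 1%g (tperm d (drev d)).
Proof.
move=> sd; apply/forallP=> e; apply/andP; split.
  case: (tpermP d (drev d) e) => [->|->|/eqP ne1 /eqP ne2]; rewrite ?drevK ?tpermL ?tpermR //.
  by rewrite tpermD // ?(inj_eq (inv_inj (@drevK G))) 1?eq_sym // (inv_eq (@drevK G)).
have -> : omap (1%g : {perm vert G}) (src e) = src e by case: (src e) => //= v; rewrite perm1.
by case: (tpermP d (drev d) e) => [->|->|//]; rewrite sd.
Qed.

Lemma src_Some d : exists v, src d = Some v.
Proof.
case E : (src d) => [v|]; first by exists v.
have E' : src (drev d) = src d by rewrite E; apply/eqP; rewrite src_drev E.
have [_ /permP/(_ d)] := haut (is_aut_swap E').
by rewrite tpermL perm1 => /eqP; rewrite (negPf (drev_neq d)).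
Qed.

Lemma rot_orbit A d : [/\ rot A (rot A (rot A d)) = d,
  uniq [:: d; rot A d; rot A (rot A d)] &
  forall e, src e = src d -> e \in [:: d; rot A d; rot A (rot A d)]].
Proof.
have [v vd] := src_Some d.
have sd : star d = [set e | src e == Some v] by rewrite /star vd.
have o3 : #|porbit (rot A) d| = 3%N by rewrite porbit_rot sd deg3.
have tr := porbit_traject (rot A) d; have un := uniq_traject_porbit (rot A) d.
have it := iter_porbit (rot A) d; rewrite o3 /= in tr un it; split=> // e se.
by rewrite -tr porbit_rot sd inE se vd.
Qed.

Lemma rot_neq A d : rot A d != d.
Proof. by have [_ /= /andP[]] := rot_orbit A d; rewrite !inE negb_or eq_sym => /andP[]. Qed.

Lemma rot2_neq A d : rot A (rot A d) != d.
Proof.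
by have [_ /= /andP[]] := rot_orbit A d; rewrite !inE negb_or eq_sym => /andP[_]; rewrite eq_sym.
Qed.

Lemma rotVE A d : (rot A)^-1%g d = rot A (rot A d).
Proof. by apply: (canLR (permK _)); have [->] := rot_orbit A d. Qed.

(** Three half-edges have only two cyclic orders, inverse to each other. *)
Lemma rot_alternative A B d : rot B d = rot A d \/ rot B d = (rot A)^-1%g d.
Proof.
have [_ _ /(_ _ (src_rot B d))] := rot_orbit A d.
rewrite !inE (negPf (rot_neq B d)) rotVE /=.
by case/orP=> /eqP; [left | right].
Qed.

(** Agreement of two rotations is thus a property of the disc, which lets it define a function on
    vertices. *)
Lemma rot_eq_invariant A B d :
  (rot B (rot A d) == rot A (rot A d)) = (rot B d == rot A d).
Proof.
have [E | E] := rot_alternative A B d.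
  rewrite E eqxx; apply/eqP; have [//|] := rot_alternative A B (rot A d).
  by rewrite permK -E => /eqP; rewrite (negPf (rot2_neq B d)).
rewrite -rotVE -E !(inj_eq perm_inj) (negPf (rot_neq A d)) E rotVE.
by rewrite (inj_eq perm_inj) (negPf (rot_neq A d)).
Qed.

(** Every dart has a source, and the orbit of [rot A] is the whole disc there, so [p] descends to
    vertices. *)
Lemma at_dart_surj A (p : dart G -> bool) :
  (forall d, p (rot A d) = p d) -> exists psi, at_dart psi =1 p.
Proof.
move=> pr; exists [ffun v => [exists d, (src d == Some v) && p d]] => d.
rewrite /at_dart; have [v vd] := src_Some d; rewrite vd /= ffunE.
apply/existsP/idP=> [[e /andP[/eqP ve]]|pd]; last by exists d; rewrite vd eqxx.
have [_ _ /(_ e)] := rot_orbit A d; rewrite ve vd => /(_ erefl).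
by rewrite !inE => /or3P[] /eqP ->; rewrite ?pr.
Qed.

(** The induced graph automorphism must be the identity; only the choice of reversed discs
    remains. *)
Lemma ribbon_equivP A B : reflect (exists psi, flips psi A B) (ribbon_equiv A B).
Proof.
apply: (iffP existsP) => [[f /existsP[g /existsP[phi /andP[/haut[_ ->] /forallP H]]]]|[psi fl]].
  have [|psi psiE] := @at_dart_surj A phi.
    by move=> d; have /and3P[/eqP] := H d.
  exists psi => d; rewrite !psiE; have /and3P[_ /eqP] := H d.
  by rewrite !perm1 => -> /eqP.
exists 1%g; apply/existsP; exists 1%g; apply/existsP; exists [ffun d => at_dart psi d].
apply/andP; split.
  apply/forallP=> d; rewrite !perm1 eqxx /=.
  by case: (src d) => //= v; rewrite perm1.
apply/forallP=> d; have [r s] := fl d.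
by rewrite !ffunE !perm1 at_dart_rot eqxx r s !eqxx.
Qed.

Lemma flips_refl A : flips [ffun=> false] A A.
Proof.
move=> d; rewrite /at_dart.
by case: (src d) (src (drev d)) => [?|] [?|]; rewrite /= ?ffunE ?addbF.
Qed.

Lemma ribbon_equiv_refl A : ribbon_equiv A A.
Proof. by apply/ribbon_equivP; exists [ffun=> false]; exact: flips_refl. Qed.

Lemma ribbon_equiv_sym A B : ribbon_equiv A B -> ribbon_equiv B A.
Proof. by case/ribbon_equivP=> psi /flips_sym fl; apply/ribbon_equivP; exists psi. Qed.

Lemma ribbon_equiv_trans A B C : ribbon_equiv A B -> ribbon_equiv B C -> ribbon_equiv A C.
Proof.
move=> /ribbon_equivP[psi1 fl1] /ribbon_equivP[psi2 fl2].
by apply/ribbon_equivP; exists (addf psi1 psi2); exact: flips_trans fl1 fl2.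
Qed.

Lemma orientable_equiv_twist A B : orientable A -> orientable B ->
  exists nu, ribbon_equiv (vertex_twist A nu) B.
Proof.
move=> /existsP[o1 /forallP o1P] /existsP[o2 /forallP o2P].
have [|psi psiE] := @at_dart_surj A (fun d => rot B d != rot A d).
  by move=> d; rewrite rot_eq_invariant.
have [|a1 a1E] := @at_dart_surj A o1; first by move=> d; have /andP[/eqP] := o1P d.
have [|a2 a2E] := @at_dart_surj B o2; first by move=> d; have /andP[/eqP] := o2P d.
(* The discs to reverse are those where the rotations differ. As the signs of [A] and [B] are the
   coboundaries of [a1] and [a2], the twist must supply [a1], [a2] and a correction by [psi]. *)
exists (addf psi (addf a1 a2)); apply/ribbon_equivP; exists psi => d; split.
  rewrite -[rot (vertex_twist _ _)]/(rot A) psiE; case: ifPn => [ne|/negPn/eqP //].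
  apply: (canRL (permK _)); have [|->] := rot_alternative A B (rot A d); last by rewrite permK.
  by move/eqP; rewrite rot_eq_invariant (negPf ne).
have /andP[_ /eqP ->] := o2P d; rewrite sgn_vertex_twist; have /andP[_ /eqP ->] := o1P d.
rewrite !at_dartD -!a1E -!a2E.
by at_dart_cases.
Qed.

(** The ribbon graph chosen by [xget] is equivalent to a vertex twist of [A], so its polynomial is
    that of [A] up to sign. *)
Lemma vertex_polyE A : orientable A -> nonnegative A ->
  vertex_poly G = ribbon_vertex_poly A.
Proof.
move=> oA [N1 nnA]; rewrite /vertex_poly; set P := (X in classical_sets.xget _ X).
have /(classical_sets.xgetPex 0) : exists p, P p.
  by exists (ribbon_vertex_poly A), A; split=> //; exists N1.
case=> B [oB [N2 nnB] ->].
have [mu /ribbon_equivP[psi /ribbon_vertex_poly_flips E]] := orientable_equiv_twist oA oB.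
move: nnB; rewrite -{}E ribbon_vertex_poly_twist -sgnf_card -signr_odd.
case: (odd _); rewrite ?scale1r // expr1 scaleN1r => nnB.
(* If the sign is negative, the polynomial and its opposite are both nonnegative for large [n],
   which forces it to vanish. *)
suff -> : ribbon_vertex_poly A = 0 by rewrite oppr0.
apply: (@eventually_zero_poly _ (maxn N1 N2)) => n; rewrite geq_max => /andP[n1 n2].
by apply/le_anti; rewrite nnA // andbT -oppr_ge0 -hornerN nnB.
Qed.

(** * Parity of the number of half-twists *)

Lemma card_at_dart nu : #|[set d | at_dart nu d]| = (3 * #|[set v | nu v]|)%N.
Proof.
transitivity (\sum_(v | nu v) \sum_d (src d == Some v))%N.
  rewrite exchange_big -sum1_card big_mkcond; apply: eq_bigr => d _.
  rewrite inE /at_dart; have [w ->] := src_Some d; rewrite /=.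
  case: ifPn => nw.
    rewrite (bigD1 w) //= eqxx big1 ?addn0 // => v /andP[_ ne].
    by rewrite (inj_eq Some_inj) eq_sym (negPf ne).
  rewrite big1 // => v nv; rewrite (inj_eq Some_inj).
  by case: eqP nw => // ->; rewrite nv.
rewrite (eq_bigr (fun=> 3%N)) => [|v _]; first by rewrite sum_nat_const cardsE mulnC.
by rewrite -(deg3 v) -sum1_card [RHS]big_mkcond; apply: eq_bigr => d _; rewrite inE; case: eqP.
Qed.

(** [drev] is an involution without fixed points, so [U] splits into pairs, removed one at a
    time. *)
Lemma even_card_drev_closed (U : {set dart G}) :
  (forall d, (drev d \in U) = (d \in U)) -> ~~ odd #|U|.
Proof.
have [m] := ubnP #|U|; elim: m U => // m IH U; rewrite ltnS => Um clU.
have [->|[d dU]] := set_0Vmem U; first by rewrite cards0.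
have rU : drev d \in U :\ d by rewrite !inE drev_neq clU.
have E : #|U| = #|U :\ d :\ drev d|.+2.
  by rewrite (cardsD1 d) dU (cardsD1 (drev d)) rU.
rewrite E /= negbK; apply: IH => [|e]; first by rewrite E in Um; lia.
by rewrite !inE clU (inj_eq (inv_inj (@drevK G))) (inv_eq (@drevK G)) andbCA.
Qed.

(** In this form parity is additive under symmetric difference. *)
Lemma odd_card_addb (p : pred (dart G)) : odd #|[set d | p d]| = \big[addb/false]_d p d.
Proof.
rewrite -sum1_card (big_morph odd oddD (erefl : odd 0 = false)) big_mkcond.
by apply: eq_bigr => d _; rewrite inE; case: (p d).
Qed.

(** Two sets of half-twists relating [A] and [B] agree modulo 2 on each band, hence in the parity of
    their size. A vertex twist has three half-twists per vertex, so its parity is that of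
    $|\nu|$. *)
Lemma twist_parityE A B nu b : ribbon_equiv (vertex_twist A nu) B ->
  twist_parity b A B = (odd #|[set v | nu v]| == b).
Proof.
case/ribbon_equivP=> psi fl.
have -> : odd #|[set v | nu v]| = odd #|[set d | at_dart nu d]| by rewrite card_at_dart oddM.
apply/existsP/eqP=> [[T /andP[/eqP <- /ribbon_equivP[psi' /flips_sym fl']]]|oddE]; last first.
  (* The half-twists of [nu] themselves, inserted into [B], undo the twist of [A]. *)
  exists [set d | at_dart nu d]; rewrite oddE eqxx; apply/ribbon_equivP; exists psi => d.
  have [r s] := flips_sym fl d; split; first exact: r.
  rewrite sgn_half_twist !inE; move: s; rewrite sgn_vertex_twist => s.
  by move: s; case: (sgn A d); case: (sgn B d); at_dart_cases.
(* Neither twist changes the rotations, and a rotation of order 3 differs from its inverse, so the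
   rotations of [A] and [B] determine the reversed discs. *)
have psiE d : at_dart psi d = at_dart psi' d.
  have [r _] := fl d; have [r' _] := fl' d.
  move: r; rewrite -[rot (vertex_twist _ _)]/(rot A) r' -[rot (half_twist _ _)]/(rot B) rotVE.
  case: (at_dart psi d) (at_dart psi' d) => [] [] // /eqP.
    by rewrite eq_sym (inj_eq perm_inj) (negPf (rot_neq B d)).
  by rewrite (inj_eq perm_inj) (negPf (rot_neq B d)).
(* With the same reversals on both sides, comparing signs shows that [T] and [nu] put the same
   number of half-twists modulo 2 into each band. *)
have u_drev d : (drev d \in T) (+) at_dart nu (drev d) = (d \in T) (+) at_dart nu d.
  have [_ s] := fl d; have [_ s'] := fl' d.
  move: s'; rewrite sgn_half_twist s sgn_vertex_twist !psiE.
  by case: (sgn A d); case: (d \in T); case: (drev d \in T); at_dart_cases.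
have /even_card_drev_closed : forall d,
    (drev d \in [set d | (d \in T) (+) at_dart nu d])
      = (d \in [set d | (d \in T) (+) at_dart nu d]).
  by move=> d; rewrite !inE u_drev.
rewrite odd_card_addb big_split /= -!odd_card_addb.
have -> : [set d | d \in T] = T by apply/setP=> d; rewrite inE.
by case: (odd _); case: (odd _).
Qed.

Lemma num_partial_colorings_equiv n A B :
  ribbon_equiv A B -> num_partial_colorings n A = num_partial_colorings n B.
Proof. by case/ribbon_equivP=> psi /num_partial_colorings_flips. Qed.

(** * Connectedness and the size of the equivalence classes *)

Hypothesis hconn : connected_graph G.

Lemma drev_invariant_constant nu :
  (forall d, at_dart nu (drev d) = at_dart nu d) -> forall v w, nu v = nu w.
Proof.
move=> nud; have [d0 d0P] := hconn.
have con d : at_dart nu d = at_dart nu d0.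
  have /connectP[p] := d0P d; elim: p d0 {d0P} => [|e p IH] d0 /= => [_ -> //|].
  case/andP=> + pe dE; rewrite (IH e) // => /orP[/eqP -> // | /andP[_ /eqP sE]].
  by rewrite /at_dart sE.
have at_v v : nu v = at_dart nu d0.
  have /card_gt0P[d] : (0 < #|[set d | src d == Some v]|)%N by rewrite deg3.
  by rewrite inE -(con d) /at_dart => /eqP ->.
by move=> v w; rewrite !at_v.
Qed.

Lemma card_equiv_twists A B : orientable A -> orientable B ->
  #|[set nu | ribbon_equiv (vertex_twist A nu) B]| = 2%N.
Proof.
move=> oA oB; have [nu0 e0] := orientable_equiv_twist oA oB.
pose tt : {ffun vert G -> bool} := [ffun=> true].
have [d0 _] := hconn; have [v0 _] := src_Some d0.
have at_tt d : at_dart tt d by rewrite /at_dart; have [v ->] := src_Some d; rewrite /= ffunE.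
(* Complementing [nu0] adds a half-twist at both ends of every band, which changes nothing; the
   vertex [v0] makes the two functions distinct. *)
suff -> : [set nu | ribbon_equiv (vertex_twist A nu) B] = [set nu0; addf tt nu0].
  rewrite cards2 (_ : nu0 != _) //; apply/eqP=> /ffunP/(_ v0).
  by rewrite !ffunE; case: (nu0 v0).
apply/setP=> nu; rewrite !inE; apply/idP/orP => [e|[/eqP -> //|/eqP ->]]; last first.
  suff -> : vertex_twist A (addf tt nu0) = vertex_twist A nu0 by [].
  apply: ribbon_inj => // d; rewrite !sgn_vertex_twist !at_dartD !at_tt.
  by case: (sgn A d); at_dart_cases.
have /ribbon_equivP[psi fl] := ribbon_equiv_trans e (ribbon_equiv_sym e0).
(* Both twists have the rotations of [A], so no disc is reversed. Equality of signs then makes the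
   sum of [nu] and [nu0] constant along bands, hence constant. *)
have psi0 d : at_dart psi d = false.
  have [] := fl d; case: (at_dart psi d) => // + _.
  rewrite -![rot (vertex_twist _ _)]/(rot A) rotVE => /eqP.
  by rewrite eq_sym (inj_eq perm_inj) (negPf (rot_neq A d)).
have /drev_invariant_constant con d : at_dart (addf nu nu0) (drev d) = at_dart (addf nu nu0) d.
  have [_] := fl d; rewrite !sgn_vertex_twist !psi0 !at_dartD.
  by case: (sgn A d); at_dart_cases.
case E : (addf nu nu0 v0); [right | left]; apply/eqP/ffunP=> v;
  by have := con v v0; rewrite E !ffunE; case: (nu v); case: (nu0 v).
Qed.

End TrivialAutomorphisms.

Theorem theoremD (G : trivalent_graph)
    (hconn : connected_graph G) (haut : trivial_aut G)
    (Gam : ribbon G) (hor : orientable Gam) (hnn : nonnegative Gam) (n : nat) :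
  (vertex_poly G).[n%:R] =
    2 * (\sum_(Gam' in distinct_oriented G | even_wrt Gam Gam')
            (num_partial_colorings n Gam')%:R
         - \sum_(Gam' in distinct_oriented G | odd_wrt Gam Gam')
            (num_partial_colorings n Gam')%:R) :> int.
Proof.
rewrite (vertex_polyE haut hor hnn) horner_ribbon_vertex_poly.
set D := [set A : ribbon G | orientable A].
have eqv : {in D & &, equivalence_rel (@ribbon_equiv G)}.
  move=> A B C _ _ _; split; first exact: ribbon_equiv_refl.
  move=> AB; apply/idP/idP; apply: ribbon_equiv_trans => //.
  exact: ribbon_equiv_sym.
have part := equivalence_partitionP eqv.
have /and3P[_ /subsetP XD /forallP tr] := transversalP part.
(* A transversal meets the class of each twist of [Gam] exactly once. *)
have unique nu : #|[set B in distinct_oriented G | ribbon_equiv (vertex_twist Gam nu) B]| = 1%N.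
  have nuD : vertex_twist Gam nu \in D by rewrite inE orientable_vertex_twist.
  have BP : [set B in D | ribbon_equiv (vertex_twist Gam nu) B]
      \in equivalence_partition (@ribbon_equiv G) D.
    by apply/imsetP; exists (vertex_twist Gam nu).
  have /implyP/(_ BP)/eqP <- := tr [set B in D | ribbon_equiv (vertex_twist Gam nu) B].
  apply: eq_card => B; rewrite !inE; case BX : (B \in distinct_oriented G) => //=.
  by have := XD B BX; rewrite inE => ->.
(* Each twist is replaced by the representative of its class; the inner sum has one term. *)
transitivity (\sum_nu \sum_(B in distinct_oriented G | ribbon_equiv (vertex_twist Gam nu) B)
   sgnf nu * (num_partial_colorings n B)%:R).
  apply: eq_bigr => nu _.
  under eq_bigr => B /andP[_ e] do rewrite -(num_partial_colorings_equiv haut n e).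
  by rewrite -big_set sumr_const unique mulr1n.
rewrite (exchange_big_dep (mem (distinct_oriented G))) /=; last by move=> nu B _ /andP[].
rewrite [X in _ = 2 * (X - _)]big_mkcondr [X in _ = 2 * (_ - X)]big_mkcondr -sumrB mulr_sumr.
apply: eq_bigr => B BX.
have oB : orientable B by have := XD B BX; rewrite inE.
(* For fixed [B] the summand does not depend on [nu], since its sign is the parity of [B]. The two
   values of [nu] give the factor 2. *)
rewrite (eq_bigr (fun=> (if even_wrt Gam B then (num_partial_colorings n B)%:R else 0) -
  (if odd_wrt Gam B then (num_partial_colorings n B)%:R else 0))) => [|nu /andP[_ e]].
  rewrite -big_set sumr_const.
  rewrite (_ : #|_| = 2%N) ?mulr_natl // -(card_equiv_twists haut hconn hor oB).
  by apply: eq_card => nu; rewrite !inE BX.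
rewrite /even_wrt /odd_wrt !(twist_parityE haut _ e) -sgnf_card -signr_odd.
by case: (odd _); rewrite /= ?mulN1r ?mul1r ?sub0r ?subr0.
Qed.
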